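(* Consider the weight-adjusted flux-differencing modal discretization $$\frac{d\tilde u^{(\kappa,e)}}{dt}=\big(\tilde M^{(\kappa)}\big)^{-1}V^{\mathrm T}r^{(\kappa,e)},\qquad \kappa\in\{1,\dots,N_e\},\ e\in\{1,\dots,N_c\},$$ with $r^{(\kappa,e)}$ as defined in the context. Assume: (i) the SBP operators on the reference element are diagonal-norm, all share the same positive-definite matrix $W$, and have boundary operators of the form $E^{(l)}=\sum_{\zeta}\hat n_l^{(\zeta)}(R^{(\zeta)})^{\mathrm T}B^{(\zeta)}R^{(\zeta)}$; the Jacobian determinant $\mathcal J^{(\kappa)}$ of each mapping (computed exactly or approximated by an interpolant) is positive on $\hat\Omega$; (ii) the mesh is conforming in the sense defined in the context; (iii) the discrete metric identities $\bar Q^{(\kappa,m)}\mathbf 1=\mathbf 0$ hold for all $m\in\{1,\dots,d\}$ and all $\kappa\in\{1,\dots,N_e\}$, with $\bar Q^{(\kappa,m)}$ as defined in the context; (iv) the two-point fluxes $f_m^\#$ are entropy conservative and the numerical interface flux $f^*$ is entropy stable, in the senses defined in the context. Then the discretization is discretely entropy stable, satisfying $$\frac{d}{dt}\sum_{\kappa=1}^{N_e}\mathbf 1^{\mathrm T}WJ^{(\kappa)}s^{(\kappa)}(t)\le\sum_{\Gamma^{(\kappa,\zeta)}\subset\partial\Omega}\Big(\sum_{m=1}^d\mathbf 1^{\mathrm T}B^{(\zeta)}J^{(\kappa,\zeta)}N^{(\kappa,\zeta,m)}\psi^{(\kappa,\zeta,m)}(t)-\sum_{e=1}^{N_c}\big(w^{(\kappa,e)}(t)\big)^{\mathrm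 T}\big(R^{(\zeta)}\big)^{\mathrm T}B^{(\zeta)}J^{(\kappa,\zeta)}f^{( *,\kappa,\zeta,e)}(t)\Big),$$ where $s_i^{(\kappa)}(t):=\mathcal S(u_i^{(\kappa)}(t))$ for $i\in\{1,\dots,N_q\}$, $\psi_i^{(\kappa,\zeta,m)}(t):=\varPsi_m(w_i^{(\kappa,\zeta)}(t))$ for $i\in\{1,\dots,N_{q_f}^{(\zeta)}\}$, and the sum on the right is over all element facets lying on $\partial\Omega$. Moreover, this relation holds as an equality when the numerical interface flux is entropy conservative, and the right-hand side vanishes for periodic boundary conditions.
   Context: Conservation law and entropy. $d\in\{2,3\}$, $N_c\in\mathbb N$, $\Upsilon\subset\mathbb R^{N_c}$ is the (open) set of admissible states and $f_m:\Upsilon\to\mathbb R^{N_c}$, $m=1,\dots,d$, are the (differentiable) flux components of the system $\partial_tu+\sum_m\partial_{x_m}f_m(u)=0$ on a domain $\Omega\subset\mathbb R^d$. $\mathcal S:\Upsilon\to\mathbb R$ is an entropy function, i.e. strictly convex (positive-definite Hessian), with entropy flux $\mathcal F:\Upsilon\to\mathbb R^d$ satisfying $(\nabla_U\mathcal F_m(U))^{\mathrm T}=(\nabla_U\mathcal S(U))^{\mathrm T}\nabla_Uf_m(U)$ for all $U\in\Upsilon$ and all $m$. $\mathcal W:=\nabla\mathcal S$ is the map to entropy variables, $\mathcal U:\mathcal W(\Upsilon)\to\Upsilon$ its inverse, and the flux potential is $\varPsi_m(w):=w^{\mathrm T}f_m(\mathcal U(w))-\mathcal F_m(\mathcal U(w))$.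 Fluxes (definitions). A continuously differentiable $f_m^\#:\Upsilon\times\Upsilon\to\mathbb R^{N_c}$ is an entropy-conservative two-point flux if it is symmetric in its two arguments, $f_m^\#(U,U)=f_m(U)$ for all $U\in\Upsilon$, and $(\mathcal W(U^+)-\mathcal W(U^-))^{\mathrm T}f_m^\#(U^-,U^+)=\varPsi_m(\mathcal W(U^+))-\varPsi_m(\mathcal W(U^-))$ for all $U^\pm\in\Upsilon$. A numerical flux $f^*:\Upsilon\times\Upsilon\times\mathbb S^{d-1}\to\mathbb R^{N_c}$ is entropy stable if for all $n\in\mathbb S^{d-1}$ and $U,U^\pm\in\Upsilon$: $f^*(U^-,U^+,n)=-f^*(U^+,U^-,-n)$; $f^*(U,U,n)=\sum_mn_mf_m(U)$; and $(\mathcal W(U^+)-\mathcal W(U^-))^{\mathrm T}f^*(U^-,U^+,n)\le\sum_m n_m\big(\varPsi_m(\mathcal W(U^+))-\varPsi_m(\mathcal W(U^-))\big)$. It is entropy conservative if the last relation is an equality for all arguments. Reference element and SBP operators. $\hat\Omega\subset\mathbb R^d$ is the reference triangle or tetrahedron, with flat facets $\hat\Gamma^{(\zeta)}$, $\zeta\in\{1,\dots,N_f\}$, and constant outward unit normals $\hat n^{(\zeta)}$. Volume nodes $\xi^{(1)},\dots,\xi^{(N_q)}\in\hat\Omega$ are distinct; facet nodes $\xi^{(\zeta,i)}\in\hat\Gamma^{(\zeta)}$ have weights $\omega^{(\zeta,i)}\ge0$, $i\in\{1,\dots,N^{(\zeta)}_{q_f}\}$, and $B^{(\zeta)}:=\operatorname{diag}_i(\omega^{(\zeta,i)})$.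 $D^{(l)}=W^{-1}Q^{(l)}\in\mathbb R^{N_q\times N_q}$, $l=1,\dots,d$, are nodal SBP operators of degree $q$: $D^{(l)}$ exactly differentiates (with respect to $\xi_l$, at the nodes) polynomials of total degree at most $q$; $W$ is symmetric positive definite; $Q^{(l)}+(Q^{(l)})^{\mathrm T}=E^{(l)}$, where $u^{\mathrm T}E^{(l)}v=\int_{\partial\hat\Omega}uv\,\hat n_l\,d\hat s$ for nodal vectors of polynomials of degree at most some $r\ge q$. ''Diagonal-norm'' means $W$ is diagonal. $R^{(\zeta)}\in\mathbb R^{N^{(\zeta)}_{q_f}\times N_q}$ maps nodal values of polynomials of total degree at most $r^{(\zeta)}$ ($r^{(\zeta)}\ge p$) exactly to their values at the nodes of facet $\zeta$. $S^{(l)}:=Q^{(l)}-\frac12E^{(l)}$ is skew-symmetric. Geometry. The mesh consists of $N_e$ closed elements $\Omega^{(\kappa)}$ with non-overlapping interiors covering $\bar\Omega$; $\Omega^{(\kappa)}$ is the image of $\hat\Omega$ under a bijective polynomial mapping $X^{(\kappa)}$, and $\Gamma^{(\kappa,\zeta)}:=X^{(\kappa)}(\hat\Gamma^{(\zeta)})$. $\mathcal J^{(\kappa)}:\hat\Omega\to\mathbb R$ is the determinant of $\nabla_\xi X^{(\kappa)}$ or a polynomial interpolant of it; $J^{(\kappa)}:=\operatorname{diag}_i(\mathcal J^{(\kappa)}(\xi^{(i)}))$. $G^{(\kappa)}:\hat\Omega\to\mathbb R^{d\times d}$ is the adjugate of $\nabla_\xi X^{(\kappa)}$ or an approximation of it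 (metric terms). Facet quantities are computed from it: $\mathcal J^{(\kappa,\zeta)}_i:=\|G^{(\kappa)}(\xi^{(\zeta,i)})^{\mathrm T}\hat n^{(\zeta)}\|$ (assumed nonzero), $J^{(\kappa,\zeta)}:=\operatorname{diag}_i(\mathcal J_i^{(\kappa,\zeta)})$, unit normals $n^{(\kappa,\zeta)}_i:=G^{(\kappa)}(\xi^{(\zeta,i)})^{\mathrm T}\hat n^{(\zeta)}/\mathcal J_i^{(\kappa,\zeta)}$, and $N^{(\kappa,\zeta,m)}:=\operatorname{diag}_i((n_i^{(\kappa,\zeta)})_m)$. Averages: $\{\!\{G^{(\kappa)}_{lm}\}\!\}_{ij}:=\frac12\big(G^{(\kappa)}_{lm}(\xi^{(i)})+G^{(\kappa)}_{lm}(\xi^{(j)})\big)$ (size $N_q\times N_q$) and $\{\!\{\mathcal J^{(\kappa,\zeta)}n_m^{(\kappa,\zeta)}\}\!\}_{ij}:=\frac12\big[G^{(\kappa)}(\xi^{(i)})^{\mathrm T}\hat n^{(\zeta)}+G^{(\kappa)}(\xi^{(\zeta,j)})^{\mathrm T}\hat n^{(\zeta)}\big]_m$ (size $N_q\times N^{(\zeta)}_{q_f}$). Conforming mesh. Every element facet $\Gamma^{(\kappa,\zeta)}$ either lies on $\partial\Omega$ or coincides with exactly one facet $\Gamma^{(\nu,\eta)}$ of exactly one other element $\nu\neq\kappa$ (an interior interface), and two distinct elements share at most one such facet. For each interior interface $\Gamma^{(\kappa,\zeta)}=\Gamma^{(\nu,\eta)}$ there is a one-to-one correspondence $i\leftrightarrow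 j$ between the facet nodes on the two sides, with $X^{(\kappa)}(\xi^{(\zeta,i)})=X^{(\nu)}(\xi^{(\eta,j)})$, $n_i^{(\kappa,\zeta)}=-n_j^{(\nu,\eta)}$ and $\omega^{(\zeta,i)}\mathcal J_i^{(\kappa,\zeta)}=\omega^{(\eta,j)}\mathcal J_j^{(\nu,\eta)}$. Periodic boundary conditions mean that the facets on $\partial\Omega$ are paired with each other with the same node-matching properties (node positions agreeing up to the periodic translation), the exterior values being taken from the paired facet; such facets are then treated as interior interfaces, so that no boundary facets remain. Modal expansion. $\{\phi^{(i)}\}$ is a basis of the polynomials of total degree at most $p$ on $\hat\Omega$, $p\le q$; $V_{ij}:=\phi^{(j)}(\xi^{(i)})$; $M:=V^{\mathrm T}WV$ is assumed invertible. $\tilde u^{(\kappa,e)}(t)$ is the vector of modal coefficients of the $e$-th solution variable on element $\kappa$, $u^{(\kappa,e)}:=V\tilde u^{(\kappa,e)}$, and $u_i^{(\kappa)}:=(u_i^{(\kappa,1)},\dots,u_i^{(\kappa,N_c)})$. The weight-adjusted mass matrix $\tilde M^{(\kappa)}$ is defined by $(\tilde M^{(\kappa)})^{-1}:=M^{-1}V^{\mathrm T}W(J^{(\kappa)})^{-1}VM^{-1}$. Entropy projection. $\tilde w^{(\kappa,e)}:=(\tilde M^{(\kappa)})^{-1}V^{\mathrm T}WJ^{(\kappa)}\big[\mathcal W_e(u_1^{(\kappa)}),\dots,\mathcal W_e(u_{N_q}^{(\kappa)})\big]^{\mathrm T}$, $w^{(\kappa,e)}:=V\tilde w^{(\kappa,e)}$,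 $w_i^{(\kappa)}:=(w_i^{(\kappa,e)})_{e}$, $w_i^{(\kappa,\zeta)}:=([R^{(\zeta)}w^{(\kappa,e)}]_i)_{e}$. The exterior values $w_i^{(\kappa,\zeta,+)}$ are $w_j^{(\nu,\eta)}$ (with $j$ the node matched to $i$) at an interior interface, and are prescribed through the boundary conditions for facets on $\partial\Omega$. It is assumed throughout that all states are admissible: $u_i^{(\kappa)}\in\Upsilon$ and $w_i^{(\kappa)},w_i^{(\kappa,\zeta)},w_i^{(\kappa,\zeta,+)}\in\mathcal W(\Upsilon)$. Flux evaluations. $F^{(\kappa,m,e)}_{ij}:=[f_m^\#(\mathcal U(w_i^{(\kappa)}),\mathcal U(w_j^{(\kappa)}))]_e$, $F^{(\kappa,\zeta,m,e)}_{ij}:=[f_m^\#(\mathcal U(w_i^{(\kappa)}),\mathcal U(w_j^{(\kappa,\zeta)}))]_e$ ($N_q\times N_{q_f}^{(\zeta)}$), $f_i^{( *,\kappa,\zeta,e)}:=[f^*(\mathcal U(w_i^{(\kappa,\zeta)}),\mathcal U(w_i^{(\kappa,\zeta,+)}),n_i^{(\kappa,\zeta)})]_e$. Right-hand side of the scheme. With $\odot$ the Hadamard product and $\mathbf 1$ all-ones vectors of appropriate length, $$r^{(\kappa,e)}:=-\sum_{l=1}^d\Big(2S^{(l)}\odot\sum_{m=1}^d\{\!\{G^{(\kappa)}_{lm}\}\!\}\odot F^{(\kappa,m,e)}\Big)\mathbf 1-\sum_{\zeta=1}^{N_f}\Big(C^{(\kappa,\zeta,e)}\mathbf 1+(R^{(\zeta)})^{\mathrm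 T}\big(B^{(\zeta)}J^{(\kappa,\zeta)}f^{( *,\kappa,\zeta,e)}-(C^{(\kappa,\zeta,e)})^{\mathrm T}\mathbf 1\big)\Big),$$ $$C^{(\kappa,\zeta,e)}:=\big((R^{(\zeta)})^{\mathrm T}B^{(\zeta)}\big)\odot\sum_{m=1}^d\{\!\{\mathcal J^{(\kappa,\zeta)}n_m^{(\kappa,\zeta)}\}\!\}\odot F^{(\kappa,\zeta,m,e)}.$$ Hybridized operators. Let $\bar N_q:=N_q+\sum_\zeta N_{q_f}^{(\zeta)}$ and index blocks by $0$ (volume nodes) and $\zeta\in\{1,\dots,N_f\}$ (nodes of facet $\zeta$). $\bar Q^{(l)}\in\mathbb R^{\bar N_q\times\bar N_q}$ has $(0,0)$ block $S^{(l)}$, $(0,\zeta)$ block $\frac12\hat n_l^{(\zeta)}(R^{(\zeta)})^{\mathrm T}B^{(\zeta)}$, $(\zeta,0)$ block $-\frac12\hat n_l^{(\zeta)}B^{(\zeta)}R^{(\zeta)}$, $(\zeta,\zeta)$ block $\frac12\hat n_l^{(\zeta)}B^{(\zeta)}$, other blocks zero. $\bar G^{(\kappa,l,m)}$ is diagonal with entries $G_{lm}^{(\kappa)}$ evaluated at the volume nodes and then at the nodes of facets $1,\dots,N_f$. $\bar Q^{(\kappa,m)}:=\frac12\sum_{l=1}^d(\bar Q^{(l)}\bar G^{(\kappa,l,m)}+\bar G^{(\kappa,l,m)}\bar Q^{(l)})$. *)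

(* Defs.v *)
From HB Require Import structures.
From mathcomp Require Import all_boot all_order all_algebra.
(* The notations of mpoly clash with those of MathComp-Analysis. *)
From mathcomp Require Import -(notations) mpoly.
From mathcomp Require Import all_classical all_reals all_analysis.
Set Implicit Arguments.
Unset Strict Implicit.
Unset Printing Implicit Defensive.
Import Order.TTheory GRing.Theory Num.Theory.
Import numFieldNormedType.Exports.
Local Open Scope classical_set_scope.
Local Open Scope ring_scope.

(* Points of R^d, states and entropy variables are row vectors; vectors of
   nodal values and of modal coefficients are column vectors. *)

Section Preliminaries.
Context {R : realType}.

Definition dotv n (u v : 'rV[R]_n) : R := (u *m v^T) 0 0.

(* The norm of the library on 'rV_n is the maximum norm. *)
Definition enorm n (u : 'rV[R]_n) : R := Num.sqrt (dotv u u).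

Definition sphere n : set 'rV[R]_n := [set u | enorm u = 1].

Definition ones n : 'cV[R]_n := const_mx 1.

Definition hadamard m n (A B : 'M[R]_(m, n)) : 'M[R]_(m, n) :=
  map2_mx *%R A B.

Definition posdef n (A : 'M[R]_n) : Prop :=
  forall v : 'cV[R]_n, v != 0 -> 0 < (v^T *m A *m v) 0 0.

Definition grad n (g : 'rV[R]_n -> R) (x : 'rV[R]_n) : 'rV[R]_n :=
  \row_j 'D_(delta_mx 0 j) g x.

Definition hessian n (g : 'rV[R]_n -> R) (x : 'rV[R]_n) : 'M[R]_n :=
  jacobian (grad g) x.

Definition C1_on (V W : normedModType R) (A : set V) (g : V -> W) : Prop :=
  (forall x, A x -> differentiable g x) /\
  (forall v x, A x -> {for x, continuous (fun y => 'D_v g y)}).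

Definition bdry n (A : set 'rV[R]_n) : set 'rV[R]_n := closure A `\` A°.

Definition evalp n (P : mpoly n R) (x : 'rV[R]_n) : R := meval (x 0) P.

(* [mmeasure mdeg P] is [msize P], one more than the total degree. *)
Definition tdeg_le n (k : nat) (P : mpoly n R) : bool :=
  (mmeasure (@mdeg n) P <= k.+1)%N.

Definition nodal d n (x : 'I_n -> 'rV[R]_d) (P : mpoly d R) : 'cV[R]_n :=
  \col_i evalp P (x i).

(* Iterated integral over { s in R^k | 0 <= s_i, s_1 + ... + s_k <= h }. *)
Fixpoint corner_integral (k : nat) (h : R) (g : seq R -> R) : R :=
  if k is k'.+1 then
    \int[lebesgue_measure]_(x in `[0, h])
      corner_integral k' (h - x) (fun s => g (x :: s))
  else g [::].

End Preliminaries.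

Section ConservationLaw.
Variables (R : realType) (d Nc : nat).

Record conslaw := ConsLaw {
  adm : set 'rV[R]_Nc;
  flux : 'I_d -> 'rV[R]_Nc -> 'rV[R]_Nc;
  entropy : 'rV[R]_Nc -> R;
  entropy_flux : 'I_d -> 'rV[R]_Nc -> R;
  inv_evars : 'rV[R]_Nc -> 'rV[R]_Nc }.

Variable cl : conslaw.

Definition evars : 'rV[R]_Nc -> 'rV[R]_Nc := grad (entropy cl).

Definition evars_adm : set 'rV[R]_Nc := evars @` adm cl.

(* [jacobian] is the transpose of the usual matrix of partial derivatives. *)
Record conslaw_axioms : Prop := ConsLawAxioms {
  adm_open : open (adm cl);
  flux_diff : forall m u, adm cl u -> differentiable (flux cl m) u;
  entropy_diff : forall u, adm cl u -> differentiable (entropy cl) u;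
  entropy_diff2 : forall u, adm cl u -> differentiable evars u;
  entropy_posdef : forall u, adm cl u -> posdef (hessian (entropy cl) u);
  entropy_flux_diff :
    forall m u, adm cl u -> differentiable (entropy_flux cl m) u;
  entropy_flux_compat : forall m u, adm cl u ->
    grad (entropy_flux cl m) u =
      grad (entropy cl) u *m (jacobian (flux cl m) u)^T;
  inv_evarsK : forall u, adm cl u -> inv_evars cl (evars u) = u }.

Definition flux_potential (m : 'I_d) (w : 'rV[R]_Nc) : R :=
  dotv w (flux cl m (inv_evars cl w)) - entropy_flux cl m (inv_evars cl w).

Record entropy_conservative_2pt
    (fs : 'rV[R]_Nc -> 'rV[R]_Nc -> 'rV[R]_Nc) (m : 'I_d) : Prop :=
  EntropyConservative2pt {
  fs_C1 : C1_on (adm cl `*` adm cl)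
    (fun U : 'rV[R]_Nc * 'rV[R]_Nc => fs U.1 U.2);
  fs_sym : forall u v, adm cl u -> adm cl v -> fs u v = fs v u;
  fs_cons : forall u, adm cl u -> fs u u = flux cl m u;
  fs_ec : forall um up, adm cl um -> adm cl up ->
    dotv (evars up - evars um) (fs um up) =
      flux_potential m (evars up) - flux_potential m (evars um) }.

Definition potential_jump (um up : 'rV[R]_Nc) (n : 'rV[R]_d) : R :=
  \sum_m n 0 m * (flux_potential m (evars up) - flux_potential m (evars um)).

Record entropy_stable_flux
    (fstar : 'rV[R]_Nc -> 'rV[R]_Nc -> 'rV[R]_d -> 'rV[R]_Nc) : Prop :=
  EntropyStableFlux {
  fstar_conservative : forall n um up, sphere n -> adm cl um -> adm cl up ->
    fstar um up n = - fstar up um (- n);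
  fstar_consistent : forall n u, sphere n -> adm cl u ->
    fstar u u n = \sum_m n 0 m *: flux cl m u;
  fstar_es : forall n um up, sphere n -> adm cl um -> adm cl up ->
    dotv (evars up - evars um) (fstar um up n) <= potential_jump um up n }.

Definition entropy_conservative_flux
    (fstar : 'rV[R]_Nc -> 'rV[R]_Nc -> 'rV[R]_d -> 'rV[R]_Nc) : Prop :=
  entropy_stable_flux fstar /\
  forall n um up, sphere n -> adm cl um -> adm cl up ->
    dotv (evars up - evars um) (fstar um up n) = potential_jump um up n.

End ConservationLaw.

(* The reference element is the simplex with vertices [vtx]; its facet number z
   is the one opposite to vertex z, so that there are d + 1 facets. *)
Record refelem (R : realType) (d : nat) := RefElem {
  vtx : 'I_d.+1 -> 'rV[R]_d;
  nhat : 'I_d.+1 -> 'rV[R]_d;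
  Nq : nat;
  vnode : 'I_Nq -> 'rV[R]_d;
  Nqf : 'I_d.+1 -> nat;
  fnode : forall z, 'I_(Nqf z) -> 'rV[R]_d;
  fweight : forall z, 'I_(Nqf z) -> R;
  Wmx : 'M[R]_Nq;
  Qmx : 'I_d -> 'M[R]_Nq;
  Emx : 'I_d -> 'M[R]_Nq;
  Rmx : forall z, 'M[R]_(Nqf z, Nq);
  degp : nat;
  degq : nat;
  degr : nat;
  degrf : 'I_d.+1 -> nat;
  Np : nat;
  basis : 'I_Np -> mpoly d R }.

Section ReferenceElement.
Variables (R : realType) (d : nat) (re : refelem R d).

Definition ref_domain : set 'rV[R]_d :=
  [set x | exists c : 'I_d.+1 -> R,
     [/\ forall i, 0 <= c i, \sum_i c i = 1 & x = \sum_i c i *: vtx re i]].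

Definition ref_facet (z : 'I_d.+1) : set 'rV[R]_d :=
  [set x | exists c : 'I_d.+1 -> R,
     [/\ forall i, 0 <= c i, \sum_i c i = 1, c z = 0
       & x = \sum_i c i *: vtx re i]].

(* For j = 0, ..., d - 1, the vertices of facet z. *)
Definition facet_vtx (z : 'I_d.+1) (j : nat) : 'rV[R]_d :=
  vtx re (inord (bump z j)).

(* Surface integral over facet z, through the affine parametrization by
   { s in R^(d-1) | 0 <= s_i, sum_i s_i <= 1 }, whose surface element is the
   square root of the Gram determinant of the edge vectors. *)
Definition facet_integral (z : 'I_d.+1) (g : 'rV[R]_d -> R) : R :=
  let edges : 'M[R]_(d.-1, d) :=
    \matrix_(j, m) (facet_vtx z j.+1 - facet_vtx z 0%N) 0 m in
  Num.sqrt (\det (edges *m edges^T)) *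
  corner_integral d.-1 1 (fun s =>
    g (\sum_(j < d) nth 0 ((1 - \sum_(a <- s) a) :: s) j *: facet_vtx z j)).

Definition Bmx (z : 'I_d.+1) : 'M[R]_(Nqf re z) :=
  diag_mx (\row_i fweight i).

Definition Dmx (l : 'I_d) : 'M[R]_(Nq re) := invmx (Wmx re) *m Qmx re l.

Definition Smx (l : 'I_d) : 'M[R]_(Nq re) := Qmx re l - 2^-1 *: Emx re l.

Definition Vmx : 'M[R]_(Nq re, Np re) :=
  \matrix_(i, j) evalp (basis j) (vnode i).

Definition Mmx : 'M[R]_(Np re) := Vmx^T *m Wmx re *m Vmx.

Record refelem_axioms : Prop := RefElemAxioms {
  vtx_indep : \det (\matrix_(i, j) (vtx re (lift ord0 i) - vtx re ord0) 0 j)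
    != 0;
  nhat_unit : forall z, sphere (nhat re z);
  nhat_normal : forall z x y, ref_facet z x -> ref_facet z y ->
    dotv (nhat re z) (x - y) = 0;
  nhat_outward : forall z x y, ref_domain x -> ref_facet z y ->
    dotv (nhat re z) (x - y) <= 0;
  vnode_in : forall i, ref_domain (@vnode _ _ re i);
  vnode_inj : injective (@vnode _ _ re);
  fnode_in : forall z i, ref_facet z (@fnode _ _ re z i);
  fweight_ge0 : forall z i, 0 <= @fweight _ _ re z i;
  degp_q : (degp re <= degq re)%N;
  degq_r : (degq re <= degr re)%N;
  degp_rf : forall z, (degp re <= degrf re z)%N;
  D_exact : forall l P, tdeg_le (degq re) P ->
    Dmx l *m nodal (@vnode _ _ re) P = nodal (@vnode _ _ re) (mderiv l P);
  W_sym : (Wmx re)^T = Wmx re;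
  W_posdef : posdef (Wmx re);
  Q_sbp : forall l, Qmx re l + (Qmx re l)^T = Emx re l;
  E_exact : forall l P1 P2, tdeg_le (degr re) P1 -> tdeg_le (degr re) P2 ->
    ((nodal (@vnode _ _ re) P1)^T *m Emx re l *m nodal (@vnode _ _ re) P2) 0 0
    = \sum_z nhat re z 0 l *
        facet_integral z (fun x => evalp P1 x * evalp P2 x);
  R_exact : forall z P, tdeg_le (degrf re z) P ->
    Rmx re z *m nodal (@vnode _ _ re) P = nodal (@fnode _ _ re z) P;
  basis_deg : forall j, tdeg_le (degp re) (@basis _ _ re j);
  basis_span : forall P, tdeg_le (degp re) P ->
    exists! c : 'cV[R]_(Np re), P = \sum_j c j 0 *: basis j;
  M_unit : Mmx \in unitmx }.

(* [g] is the polynomial interpolant of [h] on the unisolvent nodes [y] in the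
   space of polynomials spanned by [b]. *)
Definition poly_interpolant (h g : 'rV[R]_d -> R) : Prop :=
  exists (n : nat) (y : 'I_n -> 'rV[R]_d) (b : 'I_n -> mpoly d R)
    (c : 'I_n -> R),
    [/\ forall i, ref_domain (y i),
        \matrix_(i, j) evalp (b j) (y i) \in unitmx,
        forall i, g (y i) = h (y i)
      & forall x, ref_domain x -> g x = \sum_j c j * evalp (b j) x].

End ReferenceElement.

Section MeshNodes.
Variables (R : realType) (d : nat) (re : refelem R d) (Ne : nat).

Definition efacet : Type := ('I_Ne * 'I_d.+1)%type.

(* (kappa, zeta, i) with i a node of facet zeta. *)
Definition efnode : Type := {kz : efacet & 'I_(Nqf re kz.2)}.

Definition mk_efnode (k : 'I_Ne) (z : 'I_d.+1) (i : 'I_(Nqf re z)) : efnode :=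
  existT (fun kz : efacet => 'I_(Nqf re kz.2)) (k, z) i.

End MeshNodes.

(* [nbr] and [mate] give the facet and the facet node matched to a facet and to
   a facet node; they are meaningful on interfaces only. *)
Record mesh (R : realType) (d : nat) (re : refelem R d) := Mesh {
  Ne : nat;
  Omega : set 'rV[R]_d;
  mapX : 'I_Ne -> 'I_d -> mpoly d R;
  Jdet : 'I_Ne -> 'rV[R]_d -> R;
  metric : 'I_Ne -> 'rV[R]_d -> 'M[R]_d;
  is_periodic : bool;
  nbr : efacet d Ne -> efacet d Ne;
  mate : efnode re Ne -> efnode re Ne }.

Section MeshGeometry.
Variables (R : realType) (d : nat) (re : refelem R d) (ms : mesh re).

Definition phys (k : 'I_(Ne ms)) (x : 'rV[R]_d) : 'rV[R]_d :=
  \row_m evalp (mapX k m) x.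

Definition jac_phys (k : 'I_(Ne ms)) (x : 'rV[R]_d) : 'M[R]_d :=
  \matrix_(m, l) evalp (mderiv l (mapX k m)) x.

Definition elem (k : 'I_(Ne ms)) : set 'rV[R]_d := phys k @` ref_domain re.

Definition facet (kz : efacet d (Ne ms)) : set 'rV[R]_d :=
  phys kz.1 @` ref_facet re kz.2.

Definition efnode_ref (x : efnode re (Ne ms)) : 'rV[R]_d := fnode (tagged x).

Definition efnode_phys (x : efnode re (Ne ms)) : 'rV[R]_d :=
  phys (tag x).1 (efnode_ref x).

(* G^T nhat, written as a row vector. *)
Definition scaled_normal (k : 'I_(Ne ms)) (z : 'I_d.+1) (x : 'rV[R]_d) :
  'rV[R]_d := nhat re z *m metric k x.

Definition Jfacet (x : efnode re (Ne ms)) : R :=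
  enorm (scaled_normal (tag x).1 (tag x).2 (efnode_ref x)).

Definition normal (x : efnode re (Ne ms)) : 'rV[R]_d :=
  (Jfacet x)^-1 *: scaled_normal (tag x).1 (tag x).2 (efnode_ref x).

Definition on_boundary (kz : efacet d (Ne ms)) : Prop :=
  facet kz `<=` bdry (Omega ms).

(* Periodically paired facets are treated as interior interfaces. *)
Definition boundary_facet (kz : efacet d (Ne ms)) : Prop :=
  on_boundary kz /\ ~~ is_periodic ms.

Record mesh_axioms : Prop := MeshAxioms {
  Omega_open : open (Omega ms);
  Omega_connected : connected (Omega ms);
  Omega_neq0 : Omega ms !=set0;
  phys_inj : forall k x y, ref_domain re x -> ref_domain re y ->
    phys k x = phys k y -> x = y;
  elem_disjoint : forall k v, k != v -> (elem k)° `&` (elem v)° = set0;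
  elem_cover : \bigcup_k elem k = closure (Omega ms);
  Jdet_def : forall k,
    (forall x, ref_domain re x -> Jdet k x = \det (jac_phys k x)) \/
    poly_interpolant re (fun x => \det (jac_phys k x)) (Jdet k);
  Jfacet_neq0 : forall x, Jfacet x != 0 }.

(* The exterior state at a periodic facet is taken from another facet of the
   boundary, the node positions of which agree up to a translation [tau]. *)
Record conforming : Prop := Conforming {
  conf_facet : forall kz, on_boundary kz \/
    exists! vh, vh.1 != kz.1 /\ facet kz = facet vh;
  conf_share : forall kz kz' vh vh',
    ~ on_boundary kz -> ~ on_boundary kz' ->
    kz.1 = kz'.1 -> vh.1 = vh'.1 -> kz.1 != vh.1 ->
    facet kz = facet vh -> facet kz' = facet vh' -> kz = kz' /\ vh = vh';
  conf_nbr : forall kz, ~ on_boundary kz ->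
    (nbr kz).1 != kz.1 /\ facet kz = facet (nbr kz);
  conf_mate : forall x, ~ boundary_facet (tag x) ->
    tag (mate x) = nbr (tag x) /\ mate (mate x) = x;
  conf_pos : forall x, ~ on_boundary (tag x) ->
    efnode_phys x = efnode_phys (mate x);
  conf_normal : forall x, ~ boundary_facet (tag x) ->
    normal x = - normal (mate x);
  conf_weight : forall x, ~ boundary_facet (tag x) ->
    fweight (tagged x) * Jfacet x =
      fweight (tagged (mate x)) * Jfacet (mate x);
  conf_periodic : is_periodic ms -> forall kz, on_boundary kz ->
    [/\ on_boundary (nbr kz), nbr kz != kz, nbr (nbr kz) = kz
      & exists tau : 'rV[R]_d, forall x, tag x = kz ->
          efnode_phys (mate x) = efnode_phys x + tau] }.

Definition Jmx (k : 'I_(Ne ms)) : 'M[R]_(Nq re) :=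
  diag_mx (\row_i Jdet k (vnode i)).

Definition Jfmx (k : 'I_(Ne ms)) (z : 'I_d.+1) : 'M[R]_(Nqf re z) :=
  diag_mx (\row_i Jfacet (mk_efnode k i)).

Definition Nmx (k : 'I_(Ne ms)) (z : 'I_d.+1) (m : 'I_d) : 'M[R]_(Nqf re z) :=
  diag_mx (\row_i normal (mk_efnode k i) 0 m).

Definition avgG (k : 'I_(Ne ms)) (l m : 'I_d) : 'M[R]_(Nq re) :=
  \matrix_(i, j) (2^-1 *
    (metric k (vnode i) l m + metric k (vnode j) l m)).

Definition avgJn (k : 'I_(Ne ms)) (z : 'I_d.+1) (m : 'I_d) :
    'M[R]_(Nq re, Nqf re z) :=
  \matrix_(i, j) (2^-1 *
    (scaled_normal k z (vnode i) + scaled_normal k z (fnode j)) 0 m).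

(* The inverse of the weight-adjusted mass matrix. *)
Definition Mtinv (k : 'I_(Ne ms)) : 'M[R]_(Np re) :=
  invmx (Mmx re) *m (Vmx re)^T *m Wmx re *m invmx (Jmx k) *m Vmx re
    *m invmx (Mmx re).

Definition hybridQ (l : 'I_d) : 'M[R]_(Nq re + \sum_z Nqf re z) :=
  block_mx
    (Smx re l)
    (\mxrow_z ((2^-1 * nhat re z 0 l) *: ((Rmx re z)^T *m Bmx re z)))
    (\mxcol_z (- (2^-1 * nhat re z 0 l) *: (Bmx re z *m Rmx re z)))
    (\mxdiag_z ((2^-1 * nhat re z 0 l) *: Bmx re z)).

Definition hybridG (k : 'I_(Ne ms)) (l m : 'I_d) :
    'M[R]_(Nq re + \sum_z Nqf re z) :=
  block_mx
    (diag_mx (\row_i metric k (vnode i) l m)) 0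
    0 (\mxdiag_z diag_mx (\row_(i < Nqf re z) metric k (fnode i) l m)).

Definition hybridQ_phys (k : 'I_(Ne ms)) (m : 'I_d) :
    'M[R]_(Nq re + \sum_z Nqf re z) :=
  2^-1 *: \sum_l (hybridQ l *m hybridG k l m + hybridG k l m *m hybridQ l).

Definition metric_identities : Prop :=
  forall k m, hybridQ_phys k m *m ones _ = 0.

End MeshGeometry.

Section Scheme.
Variables (R : realType) (d Nc : nat) (cl : conslaw R d Nc).
Variables (re : refelem R d) (ms : mesh re).
Variable fs : 'I_d -> 'rV[R]_Nc -> 'rV[R]_Nc -> 'rV[R]_Nc.
Variable fstar : 'rV[R]_Nc -> 'rV[R]_Nc -> 'rV[R]_d -> 'rV[R]_Nc.

(* Modal coefficients of every solution variable on every element, and values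
   prescribed by the boundary conditions, at a given time. *)
Variable a : 'I_(Ne ms) -> 'I_Nc -> 'cV[R]_(Np re).
Variable wext : efnode re (Ne ms) -> 'rV[R]_Nc.

Definition u_state (k : 'I_(Ne ms)) (i : 'I_(Nq re)) : 'rV[R]_Nc :=
  \row_e (Vmx re *m a k e) i 0.

Definition w_modal (k : 'I_(Ne ms)) (e : 'I_Nc) : 'cV[R]_(Np re) :=
  Mtinv k *m (Vmx re)^T *m Wmx re *m Jmx k
    *m \col_i evars cl (u_state k i) 0 e.

Definition w_nodal (k : 'I_(Ne ms)) (e : 'I_Nc) : 'cV[R]_(Nq re) :=
  Vmx re *m w_modal k e.

Definition w_state (k : 'I_(Ne ms)) (i : 'I_(Nq re)) : 'rV[R]_Nc :=
  \row_e w_nodal k e i 0.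

Definition w_facet (x : efnode re (Ne ms)) : 'rV[R]_Nc :=
  \row_e (Rmx re (tag x).2 *m w_nodal (tag x).1 e) (tagged x) 0.

Definition w_ext (x : efnode re (Ne ms)) : 'rV[R]_Nc :=
  if `[< boundary_facet (tag x) >] then wext x else w_facet (mate x).

Record admissible : Prop := Admissible {
  adm_u : forall k i, adm cl (u_state k i);
  adm_w : forall k i, evars_adm cl (w_state k i);
  adm_wf : forall x, evars_adm cl (w_facet x);
  adm_wext : forall x, evars_adm cl (w_ext x) }.

Definition Fvol (k : 'I_(Ne ms)) (m : 'I_d) (e : 'I_Nc) : 'M[R]_(Nq re) :=
  \matrix_(i, j)
    fs m (inv_evars cl (w_state k i)) (inv_evars cl (w_state k j)) 0 e.

Definition Ffac (k : 'I_(Ne ms)) (z : 'I_d.+1) (m : 'I_d) (e : 'I_Nc) :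
    'M[R]_(Nq re, Nqf re z) :=
  \matrix_(i, j)
    fs m (inv_evars cl (w_state k i))
         (inv_evars cl (w_facet (mk_efnode k j))) 0 e.

Definition fstar_vec (k : 'I_(Ne ms)) (z : 'I_d.+1) (e : 'I_Nc) :
    'cV[R]_(Nqf re z) :=
  \col_i fstar (inv_evars cl (w_facet (mk_efnode k i)))
               (inv_evars cl (w_ext (mk_efnode k i)))
               (normal (mk_efnode k i)) 0 e.

Definition Cmx (k : 'I_(Ne ms)) (z : 'I_d.+1) (e : 'I_Nc) :
    'M[R]_(Nq re, Nqf re z) :=
  hadamard ((Rmx re z)^T *m Bmx re z)
    (\sum_m hadamard (avgJn k z m) (Ffac k z m e)).

Definition rhs (k : 'I_(Ne ms)) (e : 'I_Nc) : 'cV[R]_(Nq re) :=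
  - (\sum_l hadamard (2 *: Smx re l)
              (\sum_m hadamard (avgG k l m) (Fvol k m e)) *m ones _)
  - \sum_z (Cmx k z e *m ones _
      + (Rmx re z)^T *m (Bmx re z *m Jfmx k z *m fstar_vec k z e
                           - (Cmx k z e)^T *m ones _)).

Definition total_entropy : R :=
  \sum_k ((ones _)^T *m Wmx re *m Jmx k
            *m \col_i entropy cl (u_state k i)) 0 0.

Definition psi_vec (k : 'I_(Ne ms)) (z : 'I_d.+1) (m : 'I_d) :
    'cV[R]_(Nqf re z) :=
  \col_i flux_potential cl m (w_facet (mk_efnode k i)).

Definition boundary_terms : R :=
  \sum_(kz : efacet d (Ne ms) | `[< boundary_facet kz >])
    (\sum_m ((ones _)^T *m Bmx re kz.2 *m Jfmx kz.1 kz.2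
               *m Nmx kz.1 kz.2 m *m psi_vec kz.1 kz.2 m) 0 0
     - \sum_e ((w_nodal kz.1 e)^T *m (Rmx re kz.2)^T *m Bmx re kz.2
                 *m Jfmx kz.1 kz.2 *m fstar_vec kz.1 kz.2 e) 0 0).

End Scheme.

(* [ut t] are the modal coefficients at time t; [wext t x] is the exterior value
   of the entropy variables at the node x of a boundary facet. *)
Definition solves (R : realType) (d Nc : nat) (cl : conslaw R d Nc)
    (re : refelem R d) (ms : mesh re)
    (fs : 'I_d -> 'rV[R]_Nc -> 'rV[R]_Nc -> 'rV[R]_Nc)
    (fstar : 'rV[R]_Nc -> 'rV[R]_Nc -> 'rV[R]_d -> 'rV[R]_Nc)
    (ut : R -> 'I_(Ne ms) -> 'I_Nc -> 'cV[R]_(Np re))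
    (wext : R -> efnode re (Ne ms) -> 'rV[R]_Nc) (times : set R) : Prop :=
  forall t, times t -> forall k e,
    is_derive t 1 (fun s => ut s k e)
      (Mtinv k *m (Vmx re)^T *m rhs cl fs fstar (ut t) (wext t) k e).

(* Main.v *)
(* The mass-matrix inverse is symmetric, so testing the scheme with the entropy
   projection gives d/dt (entropy) = sum_e (w^e)^T r^e on every element.  In the
   volume term, S is skew and the flux matrix symmetric, so that (entropy
   conservation of the two-point flux) w_i . f(w_i, w_j) may be replaced by
   psi(w_i); the facet correction becomes a combination of the differences
   psi(w_i) - psi(w_j) in the same way.  The volume rows of the metric
   identities cancel all the psi(w_i) at volume nodes, and the facet rows
   collapse the rest to sum_j omega_j J_j (n_j . psi(w_j) - w_j . f*_j) over the facet nodes.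
   Adding the contributions of two matched nodes leaves the entropy dissipation
   of f* with a negative sign; unmatched nodes make up the boundary terms. *)
Require Import Defs.
From HB Require Import structures.
From mathcomp Require Import all_boot all_order all_algebra.
From mathcomp Require Import -(notations) mpoly.
From mathcomp Require Import all_classical all_reals all_analysis.
From mathcomp Require Import ring.
Import Order.TTheory GRing.Theory Num.Theory.
Import numFieldNormedType.Exports.
Local Open Scope classical_set_scope.
Local Open Scope ring_scope.

Set Implicit Arguments.
Unset Strict Implicit.
Unset Printing Implicit Defensive.

(** * Dot products and differentiation along curves *)

Section DotProduct.
Variables (R : realType) (n : nat).
Implicit Types (u v w : 'rV[R]_n).

Lemma dotvE u v : dotv u v = \sum_i u 0 i * v 0 i.
Proof. by rewrite /dotv mxE; apply: eq_bigr => i _; rewrite mxE. Qed.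

Lemma dotvBl u v w : dotv (u - v) w = dotv u w - dotv v w.
Proof. by rewrite /dotv mulmxBl !mxE. Qed.

Lemma dotvNr u v : dotv u (- v) = - dotv u v.
Proof. by rewrite /dotv linearN mulmxN !mxE. Qed.

Lemma enormZ c u : enorm (c *: u) = `|c| * enorm u.
Proof.
rewrite /enorm /dotv linearZ -scalemxAl -scalemxAr !mxE mulrA -expr2.
by rewrite sqrtrM ?sqr_ge0// sqrtr_sqr.
Qed.

End DotProduct.

Lemma mulmx_ones (R : realType) m n (A : 'M[R]_(m, n)) i :
  (A *m ones n) i 0 = \sum_j A i j.
Proof. by rewrite mxE; apply: eq_bigr => j _; rewrite mxE mulr1. Qed.

Lemma tr_mulmx_col (R : realType) n (u v : 'cV[R]_n) :
  (u^T *m v) 0 0 = \sum_i u i 0 * v i 0.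
Proof. by rewrite mxE; apply: eq_bigr => i _; rewrite mxE. Qed.

Lemma derivable_pt_mx (R : realType) m n (f : R -> 'M[R]_(m, n)) (t : R) A i j :
  is_derive t 1 f A -> is_derive t 1 (fun s => f s i j) (A i j).
Proof.
move=> df; have /derivable_mxP dfij := @ex_derive _ _ _ _ _ _ _ df.
apply: DeriveDef; first exact: dfij.
by rewrite -[A]derive_val derive_mx ?mxE//; exact: ex_derive.
Qed.

(** Chain rule: the differential of [g] is linear, so its value at [du] expands over the canonical
    basis, on which it takes the partial derivatives gathered in [grad]. *)
Lemma is_derive_grad (R : realType) n (g : 'rV[R]_n -> R) (u : R -> 'rV[R]_n)
    (du : 'rV[R]_n) (t : R) :
  differentiable g (u t) ->
  (forall e, is_derive t 1 (fun s => u s 0 e) (du 0 e)) ->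
  is_derive t 1 (g \o u) (dotv (grad g (u t)) du).
Proof.
move=> dg du'.
have uD : derivable u t 1.
  by apply/derivable_mxP => i j; rewrite (ord1 i); exact: ex_derive.
have duE : 'D_1 u t = du.
  rewrite derive_mx//; apply/rowP => e; rewrite mxE.
  exact: derive_val.
have ud : differentiable u t by apply/derivable1_diffP.
have gud : differentiable (g \o u) t by exact: differentiable_comp.
apply: DeriveDef; first exact/derivable1_diffP.
rewrite deriveE// diff_comp//= -(deriveE (1 : R) ud) duE.
rewrite {1}(row_sum_delta du) linear_sum dotvE; apply: eq_bigr => e _.
by rewrite linearZ/= mxE deriveE// mulrC.
Qed.

(** * Reference operators and facet normals *)

Section Element.
Variables (R : realType) (d : nat) (re : refelem R d).
Hypothesis hre : refelem_axioms re.

(** The SBP property makes E = Q + Q^T symmetric, whence S + S^T = Q + Q^T - E = 0. *)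
Lemma Smx_skew l i j : Smx re l j i = - Smx re l i j.
Proof.
have Esym : (Emx re l)^T = Emx re l.
  by rewrite -(Q_sbp hre) linearD/= trmxK addrC.
have : Smx re l + (Smx re l)^T = 0.
  have -> : (Smx re l)^T = (Qmx re l)^T - 2^-1 *: Emx re l.
    by rewrite -[in RHS]Esym; apply/matrixP => a b; rewrite !mxE.
  rewrite /Smx addrACA (Q_sbp hre) -opprD -scalerDl.
  by rewrite -[X in X + X]div1r -splitr scale1r subrr.
move=> /matrixP/(_ j i); rewrite !mxE => /eqP; rewrite addr_eq0 => /eqP ->.
by [].
Qed.

Lemma RB_E z i j :
  ((Rmx re z)^T *m Bmx re z) i j = Rmx re z j i * @fweight _ _ re z j.
Proof. by rewrite /Bmx mul_mx_diag !mxE. Qed.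

End Element.

Section Normals.
Variables (R : realType) (d : nat) (re : refelem R d) (ms : mesh re).
Hypothesis hms : mesh_axioms ms.

Lemma Jfacet_normal (x : efnode re (Ne ms)) m :
  Jfacet x * normal x 0 m =
  scaled_normal (tag x).1 (tag x).2 (efnode_ref x) 0 m.
Proof. by rewrite mxE mulrA divff ?mul1r//; exact: (Jfacet_neq0 hms). Qed.

Lemma normal_sphere (x : efnode re (Ne ms)) : sphere (normal x).
Proof.
have J0 : 0 < Jfacet x by rewrite lt0r (Jfacet_neq0 hms) sqrtr_ge0.
by rewrite /sphere/= enormZ gtr0_norm ?invr_gt0// mulVf ?gt_eqF.
Qed.

End Normals.

(** * Discrete metric identities, row by row *)

Section MetricIdentities.
Variables (R : realType) (d : nat) (re : refelem R d) (ms : mesh re).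
Hypothesis hmetric : metric_identities ms.

Definition vol_col (g : 'rV[R]_d -> R) : 'cV[R]_(Nq re) :=
  \col_i g (vnode i).
Definition fac_col (g : 'rV[R]_d -> R) z : 'cV[R]_(Nqf re z) :=
  \col_i g (fnode i).
Definition hybrid_col (g : 'rV[R]_d -> R) : 'cV[R]_(Nq re + \sum_z Nqf re z) :=
  col_mx (vol_col g) (\mxcol_z fac_col g z).

Lemma hybridQ_col l g : hybridQ re l *m hybrid_col g = col_mx
  (Smx re l *m vol_col g + \sum_z (2^-1 * nhat re z 0 l) *:
      ((Rmx re z)^T *m Bmx re z *m fac_col g z))
  (\mxcol_z ((2^-1 * nhat re z 0 l) *:
      (Bmx re z *m fac_col g z - Bmx re z *m Rmx re z *m vol_col g))).
Proof.
rewrite /hybridQ /hybrid_col mul_block_col mul_mxrow_mxcol mxcol_mul.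
rewrite mul_mxdiag_mxcol -mxcolD; congr (col_mx (_ + _) _).
  by apply: eq_bigr => z _; rewrite -scalemxAl.
apply: eq_mxcol => z.
by rewrite -!scalemxAl scaleNr addrC scalerBr.
Qed.

(** Seen as samples of a constant function, the vector of ones falls under [hybridQ_col]. *)
Lemma ones_hybrid : ones (Nq re + \sum_z Nqf re z) = hybrid_col (fun=> 1).
Proof.
rewrite /hybrid_col /ones -col_mx_const -mxcol_const; congr col_mx.
  by apply/colP => i; rewrite !mxE.
by apply: eq_mxcol => z; apply/colP => i; rewrite !mxE.
Qed.

Lemma hybridG_col (k : 'I_(Ne ms)) l m (a : 'cV[R]_(Nq re))
    (b : forall z, 'cV[R]_(Nqf re z)) :
  hybridG k l m *m col_mx a (\mxcol_z b z) =
  col_mx (\col_i (metric k (vnode i) l m * a i 0))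
         (\mxcol_z \col_i (metric k (fnode i) l m * b z i 0)).
Proof.
rewrite /hybridG mul_block_col !mul0mx addr0 add0r mul_mxdiag_mxcol.
congr col_mx.
  by apply/colP => i; rewrite mul_diag_mx !mxE.
by apply: eq_mxcol => z; apply/colP => i; rewrite mul_diag_mx !mxE.
Qed.

(** The diagonal matrix [hybridG] sends ones to the samples of the metric term; the factor 1/2 of
    [hybridQ_phys] is cleared. *)
Lemma metric_identities_col (k : 'I_(Ne ms)) m :
  \sum_l (hybridQ re l *m hybrid_col (fun x => metric k x l m)
     + hybridG k l m *m (hybridQ re l *m hybrid_col (fun=> 1))) = 0.
Proof.
have := hmetric k m; rewrite /hybridQ_phys -scalemxAl.
move=> /(congr1 (fun A => 2 *: A)); rewrite scalerA divff ?pnatr_eq0//.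
rewrite scale1r scaler0 mulmx_suml => H.
rewrite -[RHS]H; apply: eq_bigr => l _.
rewrite mulmxDl -!mulmxA ones_hybrid; congr (_ *m _ + _).
rewrite /hybrid_col hybridG_col; congr col_mx.
  by apply/colP => i; rewrite !mxE mulr1.
by apply: eq_mxcol => z; apply/colP => i; rewrite !mxE mulr1.
Qed.

Lemma scaled_normalE (k : 'I_(Ne ms)) z x m :
  scaled_normal k z x 0 m = \sum_l nhat re z 0 l * metric k x l m.
Proof. by rewrite mxE. Qed.

Lemma avgJnE (k : 'I_(Ne ms)) z m i j : avgJn k z m i j =
  \sum_l 2^-1 * nhat re z 0 l *
    (metric k (vnode i) l m + metric k (fnode j) l m).
Proof.
rewrite mxE [in LHS]mxE !scaled_normalE -big_split mulr_sumr.
by apply: eq_bigr => l _ /=; ring.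
Qed.

(** This is a volume row of the identities: one of the two products carries the metric at the column
    node, the other at the row node, and their sum produces the averages. *)
Lemma metric_identities_vol (k : 'I_(Ne ms)) m i :
  2 * \sum_l \sum_j Smx re l i j * avgG k l m i j +
  \sum_z \sum_j ((Rmx re z)^T *m Bmx re z) i j * avgJn k z m i j = 0.
Proof.
have := congr1 (fun A => usubmx A i 0) (metric_identities_col k m).
rewrite linear_sum summxE linear0 [RHS]mxE => H; rewrite -[RHS]H mulr_sumr.
rewrite [in LHS](eq_bigr (fun z => \sum_l \sum_j 2^-1 * nhat re z 0 l *
  (((Rmx re z)^T *m Bmx re z) i j *
   (metric k (vnode i) l m + metric k (fnode j) l m)))); last first.
  move=> z _; rewrite exchange_big/=; apply: eq_bigr => j _.
  by rewrite avgJnE mulr_sumr; apply: eq_bigr => l _ /=; ring.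
rewrite exchange_big -big_split; apply: eq_bigr => l _ /=.
rewrite !hybridQ_col hybridG_col add_col_mx col_mxKu !mxE !summxE mulr_sumr.
rewrite mulrDr addrACA; congr (_ + _).
  rewrite mulr_sumr -big_split; apply: eq_bigr => j _ /=.
  by rewrite !mxE; field.
rewrite mulr_sumr -big_split; apply: eq_bigr => z _ /=.
rewrite !mxE !mulr_sumr -big_split; apply: eq_bigr => j _ /=.
by rewrite !mxE; ring.
Qed.

(** This is a facet row: the diagonal block contributes the metric at node j twice, which gives the
    scaled normal there, and the extrapolation block, of opposite sign, gives the averages. *)
Lemma metric_identities_fac (k : 'I_(Ne ms)) z m j :
  \sum_i ((Rmx re z)^T *m Bmx re z) i j * avgJn k z m i j =
  @fweight _ _ re z j * scaled_normal k z (fnode j) 0 m.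
Proof.
have := congr1 (fun A => submxcol (dsubmx A) z j 0) (metric_identities_col k m).
rewrite linear_sum submxcol_sum summxE linear0 submxcol0 [RHS]mxE => H.
(* The difference of the two sides is compared with the metric identity, one reference direction l
   at a time. *)
apply/esym/eqP; rewrite -subr_eq0 -[X in _ == X]H scaled_normalE.
rewrite (eq_bigr (fun i => \sum_l 2^-1 * nhat re z 0 l *
  (fweight j * Rmx re z j i *
   (metric k (vnode i) l m + metric k (fnode j) l m)))); last first.
  move=> i _; rewrite RB_E avgJnE mulr_sumr.
  by apply: eq_bigr => l _ /=; ring.
rewrite exchange_big mulr_sumr -sumrB; apply/eqP/eq_bigr => l _ /=.
rewrite !hybridQ_col hybridG_col add_col_mx col_mxKd -mxcolD mxcolK.
rewrite /Bmx !mul_diag_mx !mxE.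
rewrite mulr1 mulrBr [in RHS]mulrBr mulrBr addrACA -opprD; congr (_ - _).
  by field.
rewrite !mulr_sumr -big_split; apply: eq_bigr => i _ /=.
by rewrite !mxE; ring.
Qed.

End MetricIdentities.

(* Twice such a sum only depends on x i j - x j i. *)
Lemma skew_sum_eq (R : numFieldType) n (K x y : 'I_n -> 'I_n -> R) :
  (forall i j, K j i = - K i j) ->
  (forall i j, x i j - x j i = y i j - y j i) ->
  \sum_i \sum_j K i j * x i j = \sum_i \sum_j K i j * y i j.
Proof.
move=> Kskew xy.
have dbl z : 2 * (\sum_i \sum_j K i j * z i j) =
    \sum_i \sum_j K i j * (z i j - z j i).
  rewrite mulr_natl mulr2n {2}exchange_big -big_split; apply: eq_bigr => i _ /=.
  rewrite -big_split; apply: eq_bigr => j _ /=.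
  by rewrite (Kskew i j) mulNr mulrBr.
apply: (@mulfI _ (2 : R)); first by rewrite pnatr_eq0.
rewrite !dbl; apply: eq_bigr => i _; apply: eq_bigr => j _.
by rewrite xy.
Qed.

(** * Two-point fluxes in entropy variables *)

Section EntropyVariables.
Variables (R : realType) (d Nc : nat) (cl : conslaw R d Nc).
Hypothesis hcl : conslaw_axioms cl.

Lemma evarsK w : evars_adm cl w -> evars cl (inv_evars cl w) = w.
Proof. by case=> u hu <-; rewrite (inv_evarsK hcl). Qed.

Lemma adm_inv_evars w : evars_adm cl w -> adm cl (inv_evars cl w).
Proof. by case=> u hu <-; rewrite (inv_evarsK hcl). Qed.

(** The jump in [fs_ec] is second argument minus first; symmetry of the flux puts the arguments in
    the order used by the scheme. *)
Lemma fs_ec_evars fs m w1 w2 : entropy_conservative_2pt cl fs m ->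
  evars_adm cl w1 -> evars_adm cl w2 ->
  dotv (w1 - w2) (fs (inv_evars cl w1) (inv_evars cl w2)) =
    flux_potential cl m w1 - flux_potential cl m w2.
Proof.
move=> hfs h1 h2; have a1 := adm_inv_evars h1; have a2 := adm_inv_evars h2.
by rewrite (fs_sym hfs)// -{1}(evarsK h1) -{1}(evarsK h2) (fs_ec hfs)// !evarsK.
Qed.

End EntropyVariables.

(** With A the extrapolation to a facet, transposition moves it from the residual onto the test
    vector, which becomes the facet trace of the entropy variables. *)
Lemma tr_mulmx_correction (R : comPzRingType) n q (A : 'M[R]_(q, n))
    (w c : 'cV[R]_n) (f g : 'cV[R]_q) :
  (w^T *m (c + A^T *m (f - g))) 0 0 =
  (w^T *m c) 0 0 - ((A *m w)^T *m g) 0 0 + ((A *m w)^T *m f) 0 0.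
Proof.
rewrite trmx_mul mulmxDr -!mulmxA mulmxBr mulmxBr !mxE.
by rewrite -addrA; congr (_ + _); rewrite addrC.
Qed.

(** * Entropy balance of the residual on one element *)

Section SpatialBalance.
Variables (R : realType) (d Nc : nat) (cl : conslaw R d Nc).
Hypothesis hcl : conslaw_axioms cl.
Variables (re : refelem R d) (ms : mesh re).
Hypotheses (hre : refelem_axioms re) (hms : mesh_axioms ms).
Variable fs : 'I_d -> 'rV[R]_Nc -> 'rV[R]_Nc -> 'rV[R]_Nc.
Hypothesis hfs : forall m, entropy_conservative_2pt cl (fs m) m.
Variable fstar : 'rV[R]_Nc -> 'rV[R]_Nc -> 'rV[R]_d -> 'rV[R]_Nc.
Variable a : 'I_(Ne ms) -> 'I_Nc -> 'cV[R]_(Np re).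
Variable wext : efnode re (Ne ms) -> 'rV[R]_Nc.
Hypothesis hadm : admissible cl a wext.
Hypothesis hmetric : metric_identities ms.

Local Notation U := (inv_evars cl).
Local Notation psi := (flux_potential cl).
Local Notation wv := (w_state cl a).
Local Notation wf := (w_facet cl a).
Local Notation we := (w_ext cl a wext).

Definition node_balance (x : efnode re (Ne ms)) : R :=
  fweight (tagged x) * Jfacet x *
    (\sum_m normal x 0 m * psi m (wf x)
     - dotv (wf x) (fstar (U (wf x)) (U (we x)) (normal x))).

(** S times the symmetric average is skew in (i, j), and w_i . f_ij - w_j . f_ji = psi_i - psi_j, so
    [skew_sum_eq] replaces w_i . f_ij by psi_i. *)
Lemma volume_balance k :
  \sum_e ((w_nodal cl a k e)^T *m \sum_l hadamard (2 *: Smx re l)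
     (\sum_m hadamard (avgG k l m) (Fvol cl fs a k m e)) *m ones _) 0 0 =
  \sum_m \sum_i psi m (wv k i) *
    (2 * \sum_l \sum_j Smx re l i j * avgG k l m i j).
Proof.
(* The sum over solution variables is moved innermost to form dot products. *)
transitivity (\sum_m \sum_l 2 * \sum_i \sum_j
    (Smx re l i j * avgG k l m i j) *
      dotv (wv k i) (fs m (U (wv k i)) (U (wv k j)))).
  rewrite [RHS]exchange_big/=.
  transitivity (\sum_e \sum_l \sum_m \sum_i \sum_j
      2 * (Smx re l i j * avgG k l m i j) *
        (wv k i 0 e * fs m (U (wv k i)) (U (wv k j)) 0 e)).
    apply: eq_bigr => e _; rewrite mulmx_sumr summxE; apply: eq_bigr => l _.
    rewrite tr_mulmx_col [RHS]exchange_big; apply: eq_bigr => i _ /=.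
    rewrite mulmx_ones [RHS]exchange_big mulr_sumr; apply: eq_bigr => j _ /=.
    rewrite !mxE summxE !mulr_sumr; apply: eq_bigr => m _ /=.
    by rewrite !mxE; ring.
  rewrite exchange_big; apply: eq_bigr => l _ /=.
  rewrite exchange_big; apply: eq_bigr => m _ /=.
  rewrite exchange_big mulr_sumr; apply: eq_bigr => i _ /=.
  rewrite exchange_big mulr_sumr; apply: eq_bigr => j _ /=.
  by rewrite dotvE -mulr_sumr -mulrA.
apply: eq_bigr => m _.
transitivity (\sum_l 2 * \sum_i \sum_j
    (Smx re l i j * avgG k l m i j) * psi m (wv k i)).
  apply: eq_bigr => l _; congr (_ * _); apply: skew_sum_eq => i j.
    by rewrite (Smx_skew hre) mulNr /avgG !mxE (addrC (metric k (vnode j) l m)).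
  rewrite (fs_sym (hfs m) (adm_inv_evars hcl (adm_w hadm k j))
    (adm_inv_evars hcl (adm_w hadm k i))) -dotvBl.
  by apply: fs_ec_evars => //; exact: (adm_w hadm).
rewrite -mulr_sumr exchange_big mulr_sumr; apply: eq_bigr => i _ /=.
rewrite mulrCA; congr (_ * _); rewrite mulr_sumr; apply: eq_bigr => l _.
by rewrite mulr_sumr; apply: eq_bigr => j _; rewrite mulrC.
Qed.

(** Row sums of C are tested with volume values and column sums with facet values, so each entry
    meets the difference w_i - w_j, which entropy conservation turns into a difference of
    potentials. *)
Lemma facet_correction_balance k z :
  \sum_e (((w_nodal cl a k e)^T *m (Cmx cl fs a k z e *m ones _)) 0 0
     - ((Rmx re z *m w_nodal cl a k e)^T *m
          ((Cmx cl fs a k z e)^T *m ones _)) 0 0) =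
  \sum_m \sum_i \sum_j ((Rmx re z)^T *m Bmx re z) i j * avgJn k z m i j *
    (psi m (wv k i) - psi m (wf (mk_efnode k j))).
Proof.
transitivity (\sum_m \sum_i \sum_j
    ((Rmx re z)^T *m Bmx re z) i j * avgJn k z m i j *
      dotv (wv k i - wf (mk_efnode k j))
        (fs m (U (wv k i)) (U (wf (mk_efnode k j))))).
  transitivity (\sum_e \sum_m \sum_i \sum_j
      ((Rmx re z)^T *m Bmx re z) i j * avgJn k z m i j *
        ((wv k i - wf (mk_efnode k j)) 0 e *
           fs m (U (wv k i)) (U (wf (mk_efnode k j))) 0 e)).
    apply: eq_bigr => e _; rewrite !tr_mulmx_col.
    under eq_bigr do rewrite mulmx_ones mulr_sumr.
    under [X in _ - X]eq_bigr do rewrite mulmx_ones mulr_sumr.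
    rewrite [X in _ - X]exchange_big -sumrB [RHS]exchange_big.
    apply: eq_bigr => i _ /=.
    rewrite -sumrB [RHS]exchange_big; apply: eq_bigr => j _ /=.
    rewrite [_^T _ _]mxE -mulrBl /Cmx [hadamard _ _ _ _]mxE summxE !mulr_sumr.
    apply: eq_bigr => m _ /=.
    rewrite [hadamard _ _ _ _]mxE [Ffac _ _ _ _ _ _ _ _ _]mxE.
    have -> : (wv k i - wf (mk_efnode k j)) 0 e =
        w_nodal cl a k e i 0 - (Rmx re z *m w_nodal cl a k e) j 0.
      by rewrite !mxE.
    by ring.
  rewrite exchange_big; apply: eq_bigr => m _ /=.
  rewrite exchange_big; apply: eq_bigr => i _ /=.
  rewrite exchange_big; apply: eq_bigr => j _ /=.
  by rewrite dotvE -mulr_sumr.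
apply: eq_bigr => m _; apply: eq_bigr => i _; apply: eq_bigr => j _.
congr (_ * _); apply: fs_ec_evars => //; first exact: (adm_w hadm).
exact: (adm_wf hadm).
Qed.

Lemma facet_flux_balance k z :
  \sum_e ((Rmx re z *m w_nodal cl a k e)^T *m
    (Bmx re z *m Jfmx k z *m fstar_vec cl fstar a wext k z e)) 0 0 =
  \sum_(j < Nqf re z) fweight j * Jfacet (mk_efnode k j) *
    dotv (wf (mk_efnode k j)) (fstar (U (wf (mk_efnode k j)))
       (U (we (mk_efnode k j))) (normal (mk_efnode k j))).
Proof.
under [RHS]eq_bigr do rewrite dotvE mulr_sumr.
rewrite [RHS]exchange_big; apply: eq_bigr => e _ /=.
rewrite tr_mulmx_col; apply: eq_bigr => j _.
rewrite -mulmxA /Bmx /Jfmx !mul_diag_mx.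
by rewrite !mxE/=; ring.
Qed.

Lemma element_balance k :
  \sum_e ((w_nodal cl a k e)^T *m rhs cl fs fstar a wext k e) 0 0 =
  \sum_z \sum_(j < Nqf re z) node_balance (mk_efnode k j).
Proof.
pose vol e := ((w_nodal cl a k e)^T *m \sum_l hadamard (2 *: Smx re l)
     (\sum_m hadamard (avgG k l m) (Fvol cl fs a k m e)) *m ones _) 0 0.
pose cor e z := ((w_nodal cl a k e)^T *m (Cmx cl fs a k z e *m ones _)) 0 0
     - ((Rmx re z *m w_nodal cl a k e)^T *m
          ((Cmx cl fs a k z e)^T *m ones _)) 0 0.
pose flx e z := ((Rmx re z *m w_nodal cl a k e)^T *m
    (Bmx re z *m Jfmx k z *m fstar_vec cl fstar a wext k z e)) 0 0.
transitivity (- (\sum_e vol e + \sum_z \sum_e cor e z) - \sum_z \sum_e flx e z).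
  rewrite exchange_big/= [X in _ = _ - X]exchange_big/=.
  rewrite -big_split -opprD -big_split -sumrN; apply: eq_bigr => e _ /=.
  rewrite /rhs -opprD mulmxN mxE; congr (- _).
  rewrite mulmxDr mxE -addrA; congr (_ + _).
  rewrite mulmx_sumr summxE -big_split; apply: eq_bigr => z _ /=.
  exact: tr_mulmx_correction.
rewrite volume_balance (eq_bigr _ (fun z _ => facet_correction_balance k z)).
rewrite (eq_bigr _ (fun z _ => facet_flux_balance k z)).
(* The potential differences are split: volume potentials are kept for the volume rows of the metric
   identities, and facet potentials are collapsed by the facet rows. *)
have -> : \sum_z \sum_m \sum_i \sum_j
     ((Rmx re z)^T *m Bmx re z) i j * avgJn k z m i j *
     (psi m (wv k i) - psi m (wf (mk_efnode k j))) =
   \sum_m \sum_i psi m (wv k i) *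
      (\sum_z \sum_j ((Rmx re z)^T *m Bmx re z) i j * avgJn k z m i j)
   - \sum_z \sum_(j < Nqf re z) fweight j * Jfacet (mk_efnode k j) *
       (\sum_m normal (mk_efnode k j) 0 m * psi m (wf (mk_efnode k j))).
  transitivity (\sum_z ((\sum_m \sum_i psi m (wv k i) *
      (\sum_j ((Rmx re z)^T *m Bmx re z) i j * avgJn k z m i j))
     - \sum_m \sum_(j < Nqf re z) psi m (wf (mk_efnode k j)) *
        (\sum_i ((Rmx re z)^T *m Bmx re z) i j * avgJn k z m i j))).
    apply: eq_bigr => z _; rewrite -sumrB; apply: eq_bigr => m _.
    rewrite (eq_bigr (fun j => \sum_i psi m (wf (mk_efnode k j)) *
      (((Rmx re z)^T *m Bmx re z) i j * avgJn k z m i j))); last first.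
      by move=> j _; rewrite mulr_sumr.
    rewrite [X in _ = _ - X]exchange_big -sumrB; apply: eq_bigr => i _ /=.
    by rewrite mulr_sumr -sumrB; apply: eq_bigr => j _; ring.
  rewrite sumrB; congr (_ - _).
    rewrite exchange_big; apply: eq_bigr => m _ /=.
    rewrite exchange_big; apply: eq_bigr => i _ /=.
    by rewrite mulr_sumr.
  apply: eq_bigr => z _; rewrite exchange_big; apply: eq_bigr => j _ /=.
  rewrite mulr_sumr; apply: eq_bigr => m _.
  rewrite (metric_identities_fac hmetric).
  by have /= <- := Jfacet_normal hms (mk_efnode k j) m; ring.
(* The coefficient of each volume potential is the left-hand side of a volume row, hence zero. *)
rewrite addrA -big_split/= big1 ?add0r; last first.
  move=> m _; rewrite -big_split big1// => i _ /=.
  by rewrite -mulrDr (metric_identities_vol hmetric) mulr0.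
rewrite opprK -sumrB; apply: eq_bigr => z _; rewrite -sumrB.
by apply: eq_bigr => j _; rewrite -mulrBr.
Qed.

End SpatialBalance.

(** * Pairing of matched facet nodes *)

Section Interfaces.
Variables (R : realType) (d Nc : nat) (cl : conslaw R d Nc).
Hypothesis hcl : conslaw_axioms cl.
Variables (re : refelem R d) (ms : mesh re).
Hypotheses (hre : refelem_axioms re) (hms : mesh_axioms ms).
Hypothesis hconf : conforming ms.
Variable fstar : 'rV[R]_Nc -> 'rV[R]_Nc -> 'rV[R]_d -> 'rV[R]_Nc.
Hypothesis hfstar : entropy_stable_flux cl fstar.
Variable a : 'I_(Ne ms) -> 'I_Nc -> 'cV[R]_(Np re).
Variable wext : efnode re (Ne ms) -> 'rV[R]_Nc.
Hypothesis hadm : admissible cl a wext.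

Local Notation efnode := {kz : efacet d (Ne ms) & 'I_(Nqf re kz.2)}.
Local Notation T := (node_balance cl fstar a wext).

(** Without periodicity a facet off the boundary coincides as a set with its neighbour; with
    periodicity no facet counts as a boundary facet. *)
Lemma mate_interior (x : efnode) :
  ~ boundary_facet (tag x) -> ~ boundary_facet (tag (mate x)).
Proof.
move=> nbx; have [-> _] := conf_mate hconf nbx.
move=> [onb nper]; apply: nbx; split=> //; apply: contrapT => nonb.
have [_ fE] := conf_nbr hconf nonb.
by apply: nonb; rewrite /on_boundary fE.
Qed.

(** The slack in the entropy stability inequality of [fstar]: nonnegative in general, zero for an
    entropy conservative flux. The exterior state is the trace at the mate, as on interfaces. *)
Definition entropy_dissipation (x : efnode) : R :=
  let um := inv_evars cl (w_facet cl a x) in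
  let up := inv_evars cl (w_facet cl a (mate x)) in
  potential_jump cl um up (normal x)
    - dotv (evars cl up - evars cl um) (fstar um up (normal x)).

(** At the mate the two states are swapped, the normal and the flux change sign, and the weight is
    the same, so only jumps survive in the sum. *)
Lemma node_balance_pair (x : efnode) : ~ boundary_facet (tag x) ->
  T x + T (mate x) = - (fweight (tagged x) * Jfacet x * entropy_dissipation x).
Proof.
move=> nbx; have [_ mateK] := conf_mate hconf nbx.
have nby := mate_interior nbx.
rewrite /node_balance -(conf_weight hconf nbx) -mulrDr -mulrN; congr (_ * _).
rewrite /w_ext !asboolF// mateK /entropy_dissipation /potential_jump.
set w1 := w_facet cl a x; set w2 := w_facet cl a (mate x).
have e1 : evars_adm cl w1 := adm_wf hadm x.
have e2 : evars_adm cl w2 := adm_wf hadm (mate x).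
rewrite !evarsK//.
have -> : normal (mate x) = - normal x by rewrite (conf_normal hconf nbx) opprK.
have sx := normal_sphere hms x.
have -> : fstar (inv_evars cl w2) (inv_evars cl w1) (- normal x) =
    - fstar (inv_evars cl w1) (inv_evars cl w2) (normal x).
  by rewrite (fstar_conservative hfstar sx) ?opprK//; exact: adm_inv_evars.
rewrite dotvNr dotvBl.
have -> : \sum_m (- normal x) 0 m * flux_potential cl m w2 =
    - \sum_m normal x 0 m * flux_potential cl m w2.
  by rewrite -sumrN; apply: eq_bigr => m _; rewrite mxE mulNr.
have -> : \sum_m normal x 0 m *
      (flux_potential cl m w2 - flux_potential cl m w1) =
    \sum_m normal x 0 m * flux_potential cl m w2 -
    \sum_m normal x 0 m * flux_potential cl m w1.
  by rewrite -sumrB; apply: eq_bigr => m _; rewrite mulrBr.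
by ring.
Qed.

(** The matching is an involution of the interior nodes: reindexing one of two copies of the sum by
    [mate] puts each node with its partner. *)
Lemma interior_balance :
  2 * (\sum_(x : efnode | ~~ `[< boundary_facet (tag x) >]) T x) =
  - \sum_(x : efnode | ~~ `[< boundary_facet (tag x) >])
      fweight (tagged x) * Jfacet x * entropy_dissipation x.
Proof.
rewrite mulr_natl mulr2n.
have -> : \sum_(x : efnode | ~~ `[< boundary_facet (tag x) >]) T x +
    \sum_(x : efnode | ~~ `[< boundary_facet (tag x) >]) T x =
  \sum_(x : efnode | ~~ `[< boundary_facet (tag x) >]) (T x + T (mate x)).
  rewrite big_split; congr (_ + _) => /=.
  rewrite (reindex_onto (@mate _ _ _ ms : efnode -> efnode)
    (@mate _ _ _ ms)); last first.
    by move=> x /asboolPn/(conf_mate hconf)[].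
  (* The reindexed range asks that the mate of x be interior and that [mate] return to x; this
     amounts to x being interior. *)
  apply: eq_bigl => x; apply/andP/idP.
    move=> [/asboolPn nby /eqP mateK]; apply/asboolPn.
    by rewrite -mateK; exact: mate_interior.
  move=> /asboolPn nbx; split; last by apply/eqP; case: (conf_mate hconf nbx).
  by apply/asboolPn; exact: mate_interior.
rewrite -sumrN; apply: eq_bigr => x /asboolPn nbx.
exact: node_balance_pair.
Qed.

Lemma boundary_terms_nodes :
  boundary_terms cl fstar a wext =
  \sum_(x : efnode | `[< boundary_facet (tag x) >]) T x.
Proof.
transitivity (\sum_(kz : efacet d (Ne ms) | `[< boundary_facet kz >])
    \sum_(i : 'I_(Nqf re kz.2)) T (mk_efnode kz.1 i)).
  apply: eq_bigr => -[k z] _ /=.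
  under [RHS]eq_bigr do rewrite /node_balance mulrBr.
  rewrite sumrB; congr (_ - _).
    under [RHS]eq_bigr do rewrite mulr_sumr.
    rewrite [RHS]exchange_big; apply: eq_bigr => m _ /=.
    rewrite -!mulmxA tr_mulmx_col; apply: eq_bigr => i _.
    by rewrite /Bmx /Jfmx /Nmx !mul_diag_mx !mxE; ring.
  rewrite -facet_flux_balance; apply: eq_bigr => e _.
  by rewrite [in RHS]trmx_mul !mulmxA.
rewrite sig_big_dep; apply: eq_big => [[kz i]|[[k z] i] _] //=.
by rewrite andbT.
Qed.

Lemma sum_node_balance :
  \sum_k \sum_z \sum_(i < Nqf re z) T (mk_efnode k i) =
  boundary_terms cl fstar a wext +
  \sum_(x : efnode | ~~ `[< boundary_facet (tag x) >]) T x.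
Proof.
rewrite boundary_terms_nodes pair_bigA sig_big_dep.
rewrite [LHS](bigID (fun x : efnode => `[< boundary_facet (tag x) >]))/=.
by congr (_ + _); apply: eq_bigr => -[[k z] i].
Qed.

Lemma interior_le0 :
  \sum_(x : efnode | ~~ `[< boundary_facet (tag x) >]) T x <= 0.
Proof.
rewrite -(pmulr_rle0 _ (ltr0Sn R 1)) interior_balance oppr_le0.
apply: sumr_ge0 => x _; apply: mulr_ge0.
  by rewrite mulr_ge0 ?(fweight_ge0 hre)// sqrtr_ge0.
rewrite subr_ge0; apply: (fstar_es hfstar); first exact: normal_sphere.
  exact/adm_inv_evars/(adm_wf hadm).
exact/adm_inv_evars/(adm_wf hadm).
Qed.

Lemma interior_eq0 : entropy_conservative_flux cl fstar ->
  \sum_(x : efnode | ~~ `[< boundary_facet (tag x) >]) T x = 0.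
Proof.
move=> [_ hec]; apply: (@mulfI _ (2 : R)); first by rewrite pnatr_eq0.
rewrite interior_balance mulr0 big1 ?oppr0// => x _.
rewrite /entropy_dissipation hec ?subrr ?mulr0//; first exact: normal_sphere.
  exact/adm_inv_evars/(adm_wf hadm).
exact/adm_inv_evars/(adm_wf hadm).
Qed.

End Interfaces.

(** * Time derivative of the total entropy *)

Section EntropyRate.
Variables (R : realType) (d Nc : nat) (cl : conslaw R d Nc).
Hypothesis hcl : conslaw_axioms cl.
Variables (re : refelem R d) (ms : mesh re).
Hypothesis hre : refelem_axioms re.
Hypothesis hdiag : is_diag_mx (Wmx re).

(** W and J are both diagonal, so W commutes with the inverse of J and their product is
    symmetric. *)
Lemma Mtinv_sym (k : 'I_(Ne ms)) : (Mtinv k)^T = Mtinv k.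
Proof.
have MT : (Mmx re)^T = Mmx re.
  by rewrite /Mmx !trmx_mul trmxK (W_sym hre) mulmxA.
have JT : (Jmx k)^T = Jmx k by rewrite tr_diag_mx.
have WJ : Jmx k *m Wmx re = Wmx re *m Jmx k.
  by have /diag_mxP[D ->] := hdiag; rewrite diag_mxC.
have WJV : invmx (Jmx k) *m Wmx re = Wmx re *m invmx (Jmx k).
  (* By convention [invmx] returns a singular matrix unchanged, and then the claim is [WJ]
     itself. *)
  case: (boolP (Jmx k \in unitmx)) => Ju; last by rewrite /invmx (negPf Ju).
  apply: (can_inj (mulKmx Ju)); apply: (can_inj (mulmxK Ju)).
  by rewrite mulKVmx// mulmxA WJ -!mulmxA mulVmx// mulmx1.
rewrite /Mtinv !trmx_mul !trmx_inv MT JT (W_sym hre) trmxK -!mulmxA.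
by congr (_ *m (_ *m _)); rewrite !mulmxA WJV.
Qed.

Lemma is_derive_mulmx m n (B : 'M[R]_(m, n)) (f : R -> 'cV[R]_n) (t : R) A i :
  is_derive t 1 f A -> is_derive t 1 (fun s => (B *m f s) i 0) ((B *m A) i 0).
Proof.
move=> df; rewrite mxE.
have -> : (fun s => (B *m f s) i 0) = \sum_j (B i j \*: (fun s => f s j 0)).
  by apply/funext => s; rewrite fct_sumE mxE.
apply: is_derive_sum => j; apply: is_deriveZ; exact: derivable_pt_mx.
Qed.

Lemma total_entropyE (a : 'I_(Ne ms) -> 'I_Nc -> 'cV[R]_(Np re)) :
  total_entropy cl a =
  \sum_k \sum_i (Wmx re i i * Jdet k (vnode i)) * entropy cl (u_state a k i).
Proof.
apply: eq_bigr => k _; have /diag_mxP[D ->] := hdiag.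
rewrite -!mulmxA tr_mulmx_col; apply: eq_bigr => i _.
by rewrite /Jmx !mul_diag_mx !mxE eqxx mulr1n mul1r mulrA.
Qed.

(** Symmetry of [Mtinv] moves V Mtinv V^T from r onto W J times the nodal entropy variables, where
    it yields exactly the entropy projection. *)
Lemma entropy_rate_adjoint (a : 'I_(Ne ms) -> 'I_Nc -> 'cV[R]_(Np re)) k
    (r : 'I_Nc -> 'cV[R]_(Nq re)) :
  \sum_i (Wmx re i i * Jdet k (vnode i)) * dotv (evars cl (u_state a k i))
     (\row_e (Vmx re *m (Mtinv k *m (Vmx re)^T *m r e)) i 0) =
  \sum_e ((w_nodal cl a k e)^T *m r e) 0 0.
Proof.
under eq_bigr do rewrite dotvE mulr_sumr.
rewrite exchange_big; apply: eq_bigr => e _ /=.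
have -> : (w_nodal cl a k e)^T *m r e =
    (Wmx re *m Jmx k *m \col_i evars cl (u_state a k i) 0 e)^T *m
      (Vmx re *m (Mtinv k *m (Vmx re)^T *m r e)).
  rewrite /w_nodal /w_modal; move: (Mtinv k) (Mtinv_sym k) => P PT.
  by rewrite -!mulmxA (mulmxA (Wmx re)) !trmx_mul trmxK PT -!mulmxA.
rewrite tr_mulmx_col; apply: eq_bigr => i _.
have /diag_mxP[D ->] := hdiag.
by rewrite -(mulmxA (diag_mx D)) /Jmx !mul_diag_mx !mxE eqxx mulr1n; ring.
Qed.

(** The diagonal norm makes the total entropy a weighted sum over nodes; the chain rule applies at
    each node, with gradient the entropy variables, and [entropy_rate_adjoint] gathers the
    result. *)
Lemma is_derive_total_entropy fs fstar
    (ut : R -> 'I_(Ne ms) -> 'I_Nc -> 'cV[R]_(Np re)) wext times (t : R) :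
  solves cl fs fstar ut wext times -> times t ->
  admissible cl (ut t) (wext t) ->
  is_derive t 1 (fun s => total_entropy cl (ut s))
    (\sum_k \sum_e ((w_nodal cl (ut t) k e)^T *m
                      rhs cl fs fstar (ut t) (wext t) k e) 0 0).
Proof.
move=> hsol tt hadm.
under eq_bigr do rewrite -entropy_rate_adjoint.
have -> : (fun s => total_entropy cl (ut s)) = \sum_k \sum_i
    ((Wmx re i i * Jdet k (vnode i)) \*:
       (entropy cl \o (fun s => u_state (ut s) k i))).
  apply/funext => s; rewrite total_entropyE fct_sumE; apply: eq_bigr => k _.
  by rewrite fct_sumE.
apply: is_derive_sum => k; apply: is_derive_sum => i; apply: is_deriveZ.
apply: is_derive_grad => [|e]; first exact: entropy_diff hcl _ (adm_u hadm k i).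
rewrite mxE.
have -> : (fun s => u_state (ut s) k i 0 e) =
    (fun s => (Vmx re *m ut s k e) i 0).
  by apply/funext => s; rewrite mxE.
by apply: is_derive_mulmx; exact: hsol.
Qed.

End EntropyRate.

(** * Entropy rate as boundary terms plus interface contributions *)

Theorem theorem4 (R : realType) (d Nc : nat) (hd : d = 2%N \/ d = 3%N)
  (cl : conslaw R d Nc) (hcl : conslaw_axioms cl)
  (re : refelem R d) (hre : refelem_axioms re)
  (ms : mesh re) (hms : mesh_axioms ms)
  (fs : 'I_d -> 'rV[R]_Nc -> 'rV[R]_Nc -> 'rV[R]_Nc)
  (fstar : 'rV[R]_Nc -> 'rV[R]_Nc -> 'rV[R]_d -> 'rV[R]_Nc)
  (times : set R) (htimes : open times)
  (ut : R -> 'I_(Ne ms) -> 'I_Nc -> 'cV[R]_(Np re))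
  (wext : R -> efnode re (Ne ms) -> 'rV[R]_Nc)
  (hadm : forall t, times t -> admissible cl (ut t) (wext t))
  (hsol : solves cl fs fstar ut wext times)
  (* (i) *)
  (hdiag : is_diag_mx (Wmx re))
  (hE : forall l, Emx re l =
     \sum_z nhat re z 0 l *: ((Rmx re z)^T *m Bmx re z *m Rmx re z))
  (hJ : forall (k : 'I_(Ne ms)) x, ref_domain re x -> 0 < Jdet k x)
  (* (ii) *)
  (hconf : conforming ms)
  (* (iii) *)
  (hmetric : metric_identities ms)
  (* (iv) *)
  (hfs : forall m, entropy_conservative_2pt cl (fs m) m)
  (hfstar : entropy_stable_flux cl fstar) :
  let Ent := fun t => total_entropy cl (ut t) in
  let Bnd := fun t => boundary_terms cl fstar (ut t) (wext t) in
  forall t, times t ->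
    [/\ derivable Ent t 1,
        derive1 Ent t <= Bnd t,
        (entropy_conservative_flux cl fstar -> derive1 Ent t = Bnd t)
      & (is_periodic ms -> Bnd t = 0)].
Proof.
move=> Ent Bnd t tt; have hadmt := hadm t tt.
have dE := is_derive_total_entropy hcl hre hdiag hsol tt hadmt.
have rateE : derive1 Ent t = Bnd t + \sum_(x :
    {kz : efacet d (Ne ms) & 'I_(Nqf re kz.2)} |
    ~~ `[< boundary_facet (tag x) >]) node_balance cl fstar (ut t) (wext t) x.
  rewrite derive1E derive_val -sum_node_balance; apply: eq_bigr => k _.
  exact: element_balance.
split; first exact: ex_derive.
- by rewrite rateE gerDl; exact: interior_le0.
- by move=> hec; rewrite rateE (interior_eq0 hcl) ?addr0.
(* On a periodic mesh no facet satisfies [boundary_facet], so the sum is empty. *)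
- move=> per; rewrite /Bnd /boundary_terms big1// => kz /asboolP[_].
  by rewrite per.
Qed.
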